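(* Let $v,w\in\mathfrak{S}_n$ with $v\le w$ in Bruhat order. The Bruhat interval polytope $Q_{v,w}$ is toric (that is, $\dim Q_{v,w}=\ell(w)-\ell(v)$) if and only if every subinterval $[x,y]\subset[v,w]$ (with $x\le y$) is realized as a face of $Q_{v,w}$, that is, $Q_{x,y}$ is a face of $Q_{v,w}$ for every $[x,y]\subset[v,w]$.
   Context: $\mathfrak{S}_n$ is the symmetric group on $\{1,\dots,n\}$, $\ell(\cdot)$ is the length with respect to the simple transpositions $s_i=(i,i+1)$, and $\le$ is Bruhat order ($v\le w$ iff a reduced word of $v$ is a subword of some reduced word of $w$). For $v\le w$, $[v,w]=\{z\in\mathfrak{S}_n\mid v\le z\le w\}$, and the Bruhat interval polytope $Q_{v,w}$ is the convex hull in $\mathbb{R}^n$ of the points $(z(1),\dots,z(n))$ for $z\in[v,w]$. $Q_{v,w}$ is called toric if $\dim Q_{v,w}=\ell(w)-\ell(v)$. *)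

(* Defs.v *)
From HB Require Import structures.
From mathcomp Require Import all_boot all_order all_algebra all_fingroup.
From mathcomp Require Import all_classical all_reals convex.

Set Implicit Arguments.
Unset Strict Implicit.
Unset Printing Implicit Defensive.

Import Order.TTheory GRing.Theory Num.Theory.

Local Open Scope classical_set_scope.
Local Open Scope ring_scope.

(* The indices and values 1, ..., n of the mathematics are 0, ..., n-1 here. *)
Definition simple_transposition n (s : 'S_n) : bool :=
  [exists i : 'I_n, exists j : 'I_n, (j == i.+1 :> nat) && (s == tperm i j)].

(* Products in 'S_n compose from left to right, so a word for w here is the
   reversal of a word for w in the right-to-left convention; lengths, reduced
   words and the subword order are the same in both conventions. *)
Definition word_of n (w : 'S_n) (a : seq 'S_n) : bool :=
  all (@simple_transposition n) a && ((\prod_(s <- a) s)%g == w).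

Lemma generated_by_simple n (w : 'S_n) :
  w \in <<[set s | simple_transposition s]%SET>>%g.
Proof.
case: n w => [|n] w; first by rewrite (_ : w = 1%g) ?group1 //; apply/permP => -[].
suff H (k : nat) (hk : (k < n.+1)%N) :
    tperm ord0 (Ordinal hk) \in <<[set s : 'S_n.+1 | simple_transposition s]%SET>>%g.
  have: w \in [set: 'S_n.+1]%SET by rewrite inE.
  rewrite -(gen_tperm ord0); apply: (fintype.subsetP _).
  by rewrite gen_subG; apply/fintype.subsetP => _ /imsetP[[k hk] _ ->]; exact: H.
elim: k hk => [|k IH] hk.
  by rewrite (_ : Ordinal hk = ord0) ?tperm1 ?group1 //; apply/val_inj.
have hk' : (k < n.+1)%N by exact: ltnW.
have S : tperm (Ordinal hk') (Ordinal hk)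
    \in <<[set s : 'S_n.+1 | simple_transposition s]%SET>>%g.
  apply: mem_gen; rewrite inE; apply/existsP; exists (Ordinal hk').
  by apply/existsP; exists (Ordinal hk); rewrite !eqxx.
case: (posnP k) => [k0|k0].
  by rewrite (_ : ord0 = Ordinal hk') //; apply/val_inj; rewrite /= k0.
rewrite (_ : tperm _ _ = tperm ord0 (Ordinal hk') ^ tperm (Ordinal hk') (Ordinal hk))%g.
  by rewrite groupJ // IH.
rewrite tpermJ tpermL tpermD //; rewrite -val_eqE /= -lt0n //.
Qed.

Lemma has_word n (w : 'S_n) :
  exists k, [exists a : k.-tuple 'S_n, word_of w a].
Proof.
have [k [c cS ->]] := gen_prodgP (generated_by_simple w).
exists k; apply/existsP; exists [tuple c i | i < k].
apply/andP; split; last first.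
  by apply/eqP; rewrite big_tuple; apply: eq_bigr => i _; rewrite tnth_mktuple.
by apply/allP => _ /mapP[i _ ->]; have := cS i; rewrite inE.
Qed.

Definition coxeter_length n (w : 'S_n) : nat := ex_minn (has_word w).

Definition reduced_word n (w : 'S_n) (a : seq 'S_n) : bool :=
  word_of w a && (size a == coxeter_length w).

Definition bruhat_le n (v w : 'S_n) : Prop :=
  exists a b : seq 'S_n, [/\ reduced_word v a, reduced_word w b & subseq a b].

Definition bruhat_interval n (v w : 'S_n) : set 'S_n :=
  [set z | bruhat_le v z /\ bruhat_le z w].

Section Polytopes.
Variable R : realType.

Definition convex_hull (V : lmodType R) (S : set V) : set V :=
  smallest (fun C : set V => convex_set (C : set (convex_lmodType V))) S.

Definition affine_subspace (V : vectType R) (x : V) (U : {vspace V}) : set V :=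
  [set x + u | u in [set` U]].

Definition affine_hull (V : vectType R) (S : set V) : set V :=
  smallest (fun A => exists x U, A = affine_subspace x U) S.

(* No d qualifies when S is empty. *)
Definition has_dim (V : vectType R) (S : set V) (d : nat) : Prop :=
  exists x U, affine_hull S = affine_subspace x U /\ \dim U = d.

(* The faces cut out by valid inequalities; a = 0 gives set0 and P itself. *)
Definition is_face n (F P : set 'rV[R]_n) : Prop :=
  exists (a : 'rV[R]_n) (b : R),
    (forall x, P x -> \sum_i a 0 i * x 0 i <= b) /\
    F = P `&` [set x : 'rV[R]_n | \sum_i a 0 i * x 0 i = b].

Definition perm_point n (z : 'S_n) : 'rV[R]_n := \row_i ((z i).+1)%:R.

Definition bruhat_polytope n (v w : 'S_n) : set 'rV[R]_n :=
  convex_hull (@perm_point n @` bruhat_interval v w).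

Definition toric n (v w : 'S_n) : Prop :=
  has_dim (bruhat_polytope v w) (coxeter_length w - coxeter_length v)%N.

End Polytopes.

Arguments bruhat_polytope R {n} v w _.

(* Main.v *)
Require Import Defs.
From mathcomp Require Import all_boot all_order all_algebra all_fingroup.
From mathcomp Require Import all_classical all_reals interval_inference convex.
From mathcomp Require Import zify ring lra.

(* The heart is a statement about functionals ([facetP]): if w' is a coatom of
   [v, w] and the functional L is constant on [v, w'] with L w' <= L w, then
   L v <= L z on all of [v, w], and, when L w' < L w, equality forces z <= w'.
   Applied to the functionals that vanish on the directions of [v, w'] and on
   w - w', it shows that passing from [v, w'] to [v, w] raises the dimension by
   at most one. So dimension is at most length, subintervals of toric intervals
   are toric, and in the toric case some L satisfies L w' < L w, which makes
   Q_{v,w'} a facet; atoms are dual, and a face of a face is a face. Conversely,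
   if all Q_{v,x} are faces, a maximal chain from v to w gives strictly growing
   faces, hence the dimension is at least the length.

   [facetP] goes by induction on the length of w through the lifting property,
   which settles every case where w has a right descent s with ws <> w'. The
   statement reduces to the atoms of [v, w], where it is invariant under
   inversion, so left descents are available too; if they all give w' as well,
   then w is a simple transposition. *)
Set Implicit Arguments.
Unset Strict Implicit.
Unset Printing Implicit Defensive.

Import Order.TTheory GRing.Theory Num.Theory.

(** * Bruhat order through rank matrices, and the lifting property *)

Section Bruhat.
Variable n : nat.
Implicit Types (i j k : 'I_n) (v w x y z : 'S_n).

Definition rk z (p q : nat) : nat := \sum_(k < n | (k < p)%N) (q <= z k)%N.

(** The rank-matrix criterion for Bruhat order; [bruhat_leP] identifies it with the subword
    definition. *)
Definition ble v w : Prop := forall p q, (rk v p q <= rk w p q)%N.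

Lemma ble_refl v : ble v v. Proof. by []. Qed.

Lemma ble_trans x v w : ble v x -> ble x w -> ble v w.
Proof. by move=> vx xw p q; apply: leq_trans (vx p q) (xw p q). Qed.

Lemma rkS z i q : rk z i.+1 q = (rk z i q + (q <= z i))%N.
Proof.
rewrite /rk (bigD1 i) //= addnC; congr (_ + _)%N; apply: eq_bigl => k.
by rewrite ltnS ltn_neqAle andbC.
Qed.

Lemma ble_anti v w : ble v w -> ble w v -> v = w.
Proof.
move=> vw wv; have E p q : rk v p q = rk w p q.
  by apply/eqP; rewrite eqn_leq vw wv.
have F i q : (q <= v i)%N = (q <= w i)%N.
  by have := rkS v i q; rewrite !E rkS; do 2 case: leq => //=; lia.
apply/permP => i; apply/val_inj/eqP; rewrite eqn_leq.
by rewrite -F leqnn F leqnn.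
Qed.

Lemma tperm_adj_ltn i j a b : j = i.+1 :> nat ->
  (a, b) != (i, j) -> (a, b) != (j, i) ->
  (tperm i j a < tperm i j b)%N = (a < b)%N.
Proof.
move=> hij; rewrite !xpair_eqE.
by case: tpermP => [->|->|/eqP ai /eqP aj]; case: tpermP => [->|->|/eqP bi /eqP bj];
  rewrite ?eqxx //=; do ?[move: ai aj]; do ?[move: bi bj]; rewrite -?val_eqE /=; lia.
Qed.

Lemma rk_tperm z i j p q : j = i.+1 :> nat -> p != i.+1 ->
  rk (tperm i j * z)%g p q = rk z p q.
Proof.
move=> hij pi; rewrite /rk [RHS](reindex_inj (@perm_inj _ (tperm i j))) /=.
apply: eq_big => [k|k _]; last by rewrite permM.
by case: tpermP => [->|->|//]; rewrite ?hij; lia.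
Qed.

Lemma rkSS z i j q : j = i.+1 :> nat ->
  rk z i.+2 q = (rk z i q + (q <= z i) + (q <= z j))%N.
Proof. by move=> hij; rewrite -hij rkS hij rkS. Qed.

(* Products compose from left to right: tperm i j * z swaps the entries of z at
   the positions i and j. *)
Definition up i j z := if (z i < z j)%N then (tperm i j * z)%g else z.
Definition dn i j z := if (z i < z j)%N then z else (tperm i j * z)%g.

Lemma tpermMK i j z : (tperm i j * (tperm i j * z))%g = z.
Proof. by rewrite mulgA tperm2 mul1g. Qed.

Lemma tpermMl i j z : ((tperm i j * z)%g i = z j) * ((tperm i j * z)%g j = z i).
Proof. by rewrite !permM tpermL tpermR. Qed.

(** Swapping the entries at [i] and [j] affects only row [i.+1] of the rank matrix, and having the
    larger entry first makes that row as large as its neighbours permit. The formula is monotone in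
    the two neighbouring rows, whence the lifting property in the form of [ble_up]; [rk_dn] and
    [ble_dn] are dual. *)
Lemma rk_up i j z p q : j = i.+1 :> nat ->
  rk (up i j z) p q =
  if p == i.+1 then minn (rk z i q).+1 (rk z i.+2 q) else rk z p q.
Proof.
move=> hij; case: eqP => [->|/eqP pi]; last first.
  by rewrite /up; case: ifP => _; rewrite ?rk_tperm.
rewrite (rkSS _ _ hij) (rkS _ i) /up; case: ifP => h.
  rewrite (@rk_tperm z) ?tpermMl // ?neq_ltn ?ltnSn //; do 2 case: (leqP q) => ? /=; lia.
by lia.
Qed.

Lemma rk_dn i j z p q : j = i.+1 :> nat ->
  rk (dn i j z) p q =
  if p == i.+1 then maxn (rk z i q) (rk z i.+2 q).-1 else rk z p q.
Proof.
move=> hij; case: eqP => [->|/eqP pi]; last first.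
  by rewrite /dn; case: ifP => _; rewrite ?rk_tperm.
rewrite (rkSS _ _ hij) (rkS _ i) /dn; case: ifP => h.
  by do 2 case: (leqP q) => ? /=; lia.
by rewrite (@rk_tperm z) ?tpermMl // ?neq_ltn ?ltnSn //; do 2 case: (leqP q) => ? /=; lia.
Qed.

Lemma ble_up i j v w : j = i.+1 :> nat -> ble v w -> ble (up i j v) (up i j w).
Proof.
move=> hij vw p q; rewrite !rk_up //; case: eqP => // _.
by have := vw i q; have := vw i.+2 q; lia.
Qed.

Lemma ble_dn i j v w : j = i.+1 :> nat -> ble v w -> ble (dn i j v) (dn i j w).
Proof.
move=> hij vw p q; rewrite !rk_dn //; case: eqP => // _.
by have := vw i q; have := vw i.+2 q; lia.
Qed.

Lemma le_up i j z : j = i.+1 :> nat -> ble z (up i j z).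
Proof.
move=> hij p q; rewrite rk_up //; case: eqP => // ->.
by rewrite (rkSS _ _ hij) rkS; do 2 case: (leqP q) => ? /=; lia.
Qed.

Lemma dn_le i j z : j = i.+1 :> nat -> ble (dn i j z) z.
Proof.
move=> hij p q; rewrite rk_dn //; case: eqP => // ->.
by rewrite (rkSS _ _ hij) rkS; do 2 case: (leqP q) => ? /=; lia.
Qed.

Lemma perm_lt_total i j z : j = i.+1 :> nat -> (z j < z i)%N = ~~ (z i < z j)%N.
Proof.
move=> hij; have : z i != z j.
  by rewrite (inj_eq perm_inj) -val_eqE /= hij; lia.
by rewrite -val_eqE /=; lia.
Qed.

Lemma up_asc i j z : (z i < z j)%N -> up i j z = (tperm i j * z)%g.
Proof. by rewrite /up => ->. Qed.
Lemma up_desc i j z : (z j < z i)%N -> up i j z = z.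
Proof. by move=> h; rewrite /up ltnNge ltnW. Qed.
Lemma dn_asc i j z : (z i < z j)%N -> dn i j z = z.
Proof. by rewrite /dn => ->. Qed.
Lemma dn_desc i j z : (z j < z i)%N -> dn i j z = (tperm i j * z)%g.
Proof. by move=> h; rewrite /dn ltnNge ltnW. Qed.

Lemma up_dn i j z : j = i.+1 :> nat -> up i j (dn i j z) = up i j z.
Proof.
move=> hij; rewrite /dn; case: ifP => // /negbT; rewrite -perm_lt_total // => h.
by rewrite up_asc ?tpermMK ?up_desc ?tpermMl.
Qed.

(** * Inversions, descents and Coxeter length *)

Definition ninv z : nat := #|[pred p : 'I_n * 'I_n | (p.1 < p.2)%N && (z p.2 < z p.1)%N]|.

(** The swap matches the inversions of the two permutations one to one, except that [(i, j)] itself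
    becomes an inversion. *)
Lemma ninv_asc i j z : j = i.+1 :> nat -> (z i < z j)%N ->
  ninv (tperm i j * z)%g = (ninv z).+1.
Proof.
move=> hij zij; rewrite /ninv.
pose s := tperm i j; pose f (p : 'I_n * 'I_n) := (s p.1, s p.2).
have fK : involutive f by case=> a b; rewrite /f /= !tpermK.
rewrite (cardD1 (i, j)) inE /= !tpermMl zij hij ltnSn /= add1n; congr _.+1.
rewrite -!sum1_card [RHS](reindex_inj (inv_inj fK)); apply: eq_bigl => -[a b].
rewrite !inE /= !permM.
case: (eqVneq (a, b) (i, j)) => [[-> ->]|h1] /=.
  by rewrite /s tpermL tpermR hij; lia.
case: (eqVneq (a, b) (j, i)) => [[-> ->]|h2] /=.
  by rewrite /s tpermL tpermR hij [(z j < _)%N](perm_lt_total z hij) zij; lia.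
by rewrite tperm_adj_ltn.
Qed.

Lemma ninv_desc i j z : j = i.+1 :> nat -> (z j < z i)%N ->
  ninv z = (ninv (tperm i j * z)%g).+1.
Proof.
by move=> hij zji; rewrite -{1}(tpermMK i j z) ninv_asc // !tpermMl.
Qed.

Lemma ninv1 : ninv 1%g = 0%N.
Proof. by apply: eq_card0 => -[c d]; rewrite inE /= !perm1; case: (ltngtP c d). Qed.

Lemma ninv_le_word a z : word_of z a -> (ninv z <= size a)%N.
Proof.
rewrite /word_of; elim: a z => [|s a IH] z /=.
  by rewrite big_nil => /eqP <-; rewrite ninv1.
move=> /andP[/andP[/existsP[i /existsP[j /andP[/eqP hij /eqP ->]]] sa] /eqP pa].
have {IH} : (ninv (\prod_(s <- a) s)%g <= size a)%N by apply: IH; rewrite sa /=.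
rewrite -pa big_cons; set y := (\prod_(s <- a) s)%g => h.
have [yij|] := boolP (y i < y j)%N; first by rewrite ninv_asc.
by rewrite -perm_lt_total // => /(ninv_desc hij) E; rewrite ltnW // ltnS (leq_trans _ h) // E.
Qed.

Lemma no_descent z : (forall i j, j = i.+1 :> nat -> (z i < z j)%N) -> z = 1%g.
Proof.
move=> asc.
have mono (m : nat) i j : (j <= m)%N -> (i < j)%N -> (z i < z j)%N.
  elim: m i j => [|m IH] i j jm ij; first by lia.
  have pj : (j.-1 < n)%N by apply: leq_ltn_trans (ltn_ord j); exact: leq_pred.
  have jk : j = (Ordinal pj).+1 :> nat by rewrite /= prednK //; lia.
  have [->|] := eqVneq i (Ordinal pj); first exact: asc.
  rewrite -val_eqE /= => ik.
  by apply: ltn_trans (asc _ _ jk); apply: IH => /=; lia.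
have {}mono i j : (i < j)%N -> (z i < z j)%N by apply: mono (leqnn j).
(* A strictly increasing self-map of the indices lies above the identity; applied to [z] and to its
   inverse, this forces [z i = i]. *)
have id_le (f : 'I_n -> 'I_n) : (forall i j, (i < j)%N -> (f i < f j)%N) ->
    forall i, (i <= f i)%N.
  move=> fm i; have [m] := ubnP i; elim: m i => // m IH i im.
  case: (posnP i) => [-> //|i0].
  have hm : (i.-1 < n)%N by apply: leq_ltn_trans (ltn_ord i); exact: leq_pred.
  have := IH (Ordinal hm); have := fm (Ordinal hm) i.
  by rewrite /=; lia.
apply/permP => i; rewrite perm1; apply/val_inj/eqP; rewrite eqn_leq (id_le z) // andbT.
rewrite -{2}(permK z i); apply: (id_le (z^-1)%g) => a b ab.
rewrite ltnNge; apply/negP; rewrite leq_eqVlt => /orP[/eqP/val_inj/perm_inj|/mono].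
  by move=> E; rewrite E ltnn in ab.
by rewrite !permKV; lia.
Qed.

Lemma exists_descent z : z != 1%g ->
  exists i j, j = i.+1 :> nat /\ (z j < z i)%N.
Proof.
move=> z1; apply: contrapT => H; case/eqP: z1; apply: no_descent => i j hij.
apply: contrapT => /negP; rewrite -perm_lt_total // => h; apply: H.
by exists i, j.
Qed.

Lemma word_cons i j z a : j = i.+1 :> nat -> word_of z a ->
  word_of (tperm i j * z)%g (tperm i j :: a).
Proof.
move=> hij /andP[sa /eqP pa]; rewrite /word_of big_cons pa eqxx andbT /= sa andbT.
by apply/existsP; exists i; apply/existsP; exists j; rewrite hij !eqxx.
Qed.

Lemma word_ninv z : exists2 a, word_of z a & size a = ninv z.
Proof.
have [m] := ubnP (ninv z); elim: m z => // m IH z zm.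
have [->|/exists_descent[i [j [hij zji]]]] := eqVneq z 1%g.
  by by exists [::]; rewrite ?ninv1 // /word_of big_nil /=.
have E := ninv_desc hij zji.
have [|a wa sa] := IH (tperm i j * z)%g; first by lia.
exists (tperm i j :: a); last by rewrite /= sa E.
by rewrite -{1}(tpermMK i j z) word_cons.
Qed.

Lemma coxeter_lengthE z : coxeter_length z = ninv z.
Proof.
rewrite /coxeter_length; case: ex_minnP => m /existsP[a wa] m_min.
apply/eqP; rewrite eqn_leq -{2}(size_tuple a) (ninv_le_word wa) andbT.
have [b wb sb] := word_ninv z; apply: m_min; apply/existsP.
by rewrite -sb; exists (in_tuple b).
Qed.

Lemma ninv_eq0 z : ninv z = 0%N -> z = 1%g.
Proof.
move=> z0; apply/eqP/negPn/negP => /exists_descent[i [j [hij zji]]].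
by have := ninv_desc hij zji; lia.
Qed.

Lemma ble1 z : ble 1%g z.
Proof.
have [m] := ubnP (ninv z); elim: m z => // m IH z zm.
have [-> //|/exists_descent[i [j [hij zji]]]] := eqVneq z 1%g.
apply: ble_trans (dn_le z hij); rewrite dn_desc //; apply: IH.
by have := ninv_desc hij zji; lia.
Qed.

(** At a descent of [w], [dn] takes exactly one inversion from [w] and at most one from [v]. The
    equality case goes through the same induction, since it forces [v] to descend there too. *)
Lemma ble_ninv_leq v w : ble v w -> (ninv v <= ninv w)%N /\ (ninv v = ninv w -> v = w).
Proof.
have [m] := ubnP (ninv w); elim: m v w => // m IH v w wm vw.
have [w1|/exists_descent[i [j [hij wji]]]] := eqVneq w 1%g.
  by move: vw; rewrite w1 => vw; rewrite (ble_anti vw (ble1 v)).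
have wE := ninv_desc hij wji; have := ble_dn hij vw; rewrite (dn_desc wji).
have [vij|] := boolP (v i < v j)%N.
  by rewrite dn_asc // => /IH[|h1 h2]; [lia|split; lia].
rewrite -perm_lt_total // => vji; have vE := ninv_desc hij vji.
rewrite dn_desc // => /IH[|h1 h2]; first by lia.
by split=> [|E]; [lia|apply/(mulgI (tperm i j))/h2; lia].
Qed.

Lemma ble_eq v w : ble v w -> ninv v = ninv w -> v = w.
Proof. by case/ble_ninv_leq. Qed.

(** * Reduced words and the subword characterization *)

Lemma tperm_adj_inj i j i' j' : j = i.+1 :> nat -> j' = i'.+1 :> nat ->
  tperm i j = tperm i' j' -> i = i' /\ j = j'.
Proof.
move=> hij hij' /permP/(_ i); rewrite tpermL.
case: tpermP => [-> ->|ij' ji'|_ _ ji] //; last by move: hij; rewrite ji; lia.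
by move: hij; rewrite ij' ji' hij'; lia.
Qed.

(** The tail is a word for [tperm i j * z]; were the head not a descent of [z], that permutation
    would be longer than its word. *)
Lemma word_head s a z : reduced_word z (s :: a) ->
  exists i j, [/\ j = i.+1 :> nat, s = tperm i j, (z j < z i)%N &
    reduced_word (tperm i j * z)%g a].
Proof.
rewrite /reduced_word !coxeter_lengthE => /andP[/andP[/= /andP[/existsP[i]]]].
move=> /existsP[j /andP[/eqP hij /eqP ->]] sa /eqP; rewrite big_cons => pa /eqP sz.
exists i, j; have wy : word_of (tperm i j * z)%g a.
  by rewrite /word_of sa -pa tpermMK eqxx.
have := ninv_le_word wy; have [zij|] := boolP (z i < z j)%N.
  by rewrite ninv_asc // -sz /=; lia.
rewrite -perm_lt_total // => zji _; split => //.
by rewrite coxeter_lengthE wy /=; have := ninv_desc hij zji; lia.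
Qed.

Lemma reduced_cons i j z a : j = i.+1 :> nat -> (z j < z i)%N ->
  reduced_word (tperm i j * z)%g a -> reduced_word z (tperm i j :: a).
Proof.
move=> hij zji; rewrite /reduced_word !coxeter_lengthE => /andP[wa /eqP sa].
rewrite -{1}(tpermMK i j z) word_cons //=.
by rewrite sa (ninv_desc hij zji).
Qed.

Lemma reduced_nil z : reduced_word z [::] -> z = 1%g.
Proof. by move=> /andP[/andP[_]]; rewrite big_nil => /eqP. Qed.

(** From words to ranks: follow a reduced word of [w], lifting with [ble_up] when the subword uses
    the letter and with [dn_le] when it skips it. From ranks to words: apply [ble_dn] at a descent
    of [w]; the letter enters the subword exactly when it is a descent of [v] as well. *)
Lemma bruhat_leP v w : bruhat_le v w <-> ble v w.
Proof.
split=> [[a [b [ra rb]]]|].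
  elim: b a v w ra rb => [|s b IH] a v w ra rb.
    by rewrite subseq0 => /eqP aE; rewrite aE in ra; rewrite (reduced_nil ra) (reduced_nil rb).
  have [i [j [hij sE wji {}rb]]] := word_head rb.
  case: a ra => [/reduced_nil -> _|s' a ra]; first exact: ble1.
  rewrite /= sE; case: eqP => [s'E sab|_ sab].
    have [i' [j' [hij' sE' vji ra']]] := word_head ra.
    have [ii jj] := tperm_adj_inj hij' hij (etrans (esym sE') s'E).
    subst i' j'.
    have := ble_up hij (IH _ _ _ ra' rb sab).
    by rewrite !up_asc ?tpermMl // !tpermMK.
  apply: ble_trans (IH _ _ _ ra rb sab) _.
  by rewrite -(dn_desc wji); exact: dn_le.
have [m] := ubnP (ninv w); elim: m v w => // m IH v w wm vw.
have [w1|/exists_descent[i [j [hij wji]]]] := eqVneq w 1%g.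
  move: vw; rewrite w1 => vw; rewrite (ble_anti vw (ble1 v)); exists [::], [::].
  by rewrite /reduced_word coxeter_lengthE ninv1 /word_of big_nil eqxx.
have wE := ninv_desc hij wji; have := ble_dn hij vw; rewrite (dn_desc wji).
have [vij|] := boolP (v i < v j)%N.
  rewrite dn_asc // => /IH[|a [b [ra rb sab]]]; first by lia.
  exists a, (tperm i j :: b); split=> //; first exact: reduced_cons.
  exact: subseq_trans sab (subseq_cons _ _).
rewrite -perm_lt_total // => vji.
rewrite dn_desc // => /IH[|a [b [ra rb sab]]]; first by lia.
by exists (tperm i j :: a), (tperm i j :: b); rewrite /= eqxx; split=> //; exact: reduced_cons.
Qed.

(** * Symmetries: inversion and the longest element *)

Lemma word_ofV a z : word_of z a -> word_of (z^-1)%g (rev a).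
Proof.
rewrite /word_of all_rev => /andP[sa /eqP <-]; rewrite sa /=; apply/eqP.
elim: a sa => [|s a IH] /=; first by rewrite !big_nil invg1.
move=> /andP[/existsP[i /existsP[j /andP[_ /eqP ->]]] /IH E].
by rewrite rev_cons -cats1 big_cat big_cons big_nil /= E big_cons invMg tpermV mulg1.
Qed.

Lemma ninvV z : ninv (z^-1)%g = ninv z.
Proof.
have H y : (ninv (y^-1)%g <= ninv y)%N.
  by have [a /word_ofV/ninv_le_word wa <-] := word_ninv y; rewrite -(size_rev a).
by apply/eqP; rewrite eqn_leq H -{1}(invgK z) H.
Qed.

Lemma bleV v w : ble v w -> ble (v^-1)%g (w^-1)%g.
Proof.
move=> /bruhat_leP[a [b [ra rb sab]]]; apply/bruhat_leP; exists (rev a), (rev b).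
move: ra rb; rewrite /reduced_word !coxeter_lengthE !size_rev !ninvV subseq_rev.
by move=> /andP[/word_ofV -> ->] /andP[/word_ofV -> ->].
Qed.

(* The longest element exchanges the roles of atoms and coatoms. *)
Definition flip z : 'S_n := (z * perm rev_ord_inj)%g.

Lemma flipE z i : flip z i = (n - (z i).+1)%N :> nat.
Proof. by rewrite /flip permM permE. Qed.

Lemma flipK : involutive flip.
Proof.
move=> z; apply/permP => i; apply/val_inj; rewrite /= !flipE.
by have := ltn_ord (z i); lia.
Qed.

Lemma rk_flip z p q : (q <= n)%N ->
  (rk (flip z) p q + rk z p (n - q) = \sum_(k < n | (k < p)%N) 1)%N.
Proof.
move=> qn; rewrite /rk -big_split /=; apply: eq_bigr => k _; rewrite flipE.
by have := ltn_ord (z k); do 2 case: leqP => ? /=; lia.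
Qed.

Lemma rk_big z p q : (n <= q)%N -> rk z p q = 0%N.
Proof.
move=> nq; rewrite /rk big1 // => k _; case: leqP => // qk.
by have := ltn_ord (z k); lia.
Qed.

Lemma ble_flip v w : ble v w -> ble (flip w) (flip v).
Proof.
move=> vw p q; case: (leqP q n) => qn; last by rewrite !rk_big // ltnW.
by have := rk_flip v p qn; have := rk_flip w p qn; have := vw p (n - q)%N; lia.
Qed.

Lemma ble_flipE v w : ble (flip w) (flip v) <-> ble v w.
Proof. by split=> /ble_flip; rewrite ?flipK. Qed.

(** Each pair of positions is an inversion of exactly one of [z] and [flip z]. *)
Lemma ninv_flip z :
  (ninv (flip z) + ninv z = \sum_(p : 'I_n * 'I_n | (p.1 < p.2)%N) 1)%N.
Proof.
have invE y : ninv y = (\sum_(p : 'I_n * 'I_n | (p.1 < p.2)%N) (y p.2 < y p.1)%N)%N.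
  rewrite /ninv -sum1_card big_mkcondr /=; apply: eq_bigr => -[a b] _ /=.
  by case: leqP.
rewrite !invE -big_split /=; apply: eq_bigr => -[a b] /= ab; rewrite !flipE.
have : z a != z b by rewrite (inj_eq perm_inj) -val_eqE neq_ltn ab.
rewrite -val_eqE /=; have := ltn_ord (z a); have := ltn_ord (z b).
by do 2 case: ltnP => ?; lia.
Qed.

(** * Covers, atoms and coatoms *)

Definition cov v w : Prop := ble v w /\ ninv w = (ninv v).+1.

Lemma cov_flip v w : cov v w -> cov (flip w) (flip v).
Proof.
move=> [vw E]; split; first exact: ble_flip.
by have := ninv_flip v; have := ninv_flip w; lia.
Qed.

Lemma covV v w : cov v w -> cov (v^-1)%g (w^-1)%g.
Proof. by move=> [vw E]; split; [exact: bleV|rewrite !ninvV]. Qed.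

(** Let s be a descent of [w]. If [v] ascends there, sw is a coatom above [v]. Otherwise take a
    coatom of [[sv, sw]]: if it ascends at s, its swap is the coatom sought; if it descends, [v]
    lies below it, hence below sw. *)
Lemma exists_coatom v w : ble v w -> v != w -> exists2 w', ble v w' & cov w' w.
Proof.
have [m] := ubnP (ninv w); elim: m v w => // m IH v w wm vw nvw.
have [w1|/exists_descent[i [j [hij wji]]]] := eqVneq w 1%g.
  by move: vw nvw; rewrite w1 => vw; rewrite (ble_anti vw (ble1 v)) eqxx.
have wE := ninv_desc hij wji; have vw' := ble_dn hij vw; rewrite (dn_desc wji) in vw'.
have sw : cov (tperm i j * w)%g w by split=> //; rewrite -(dn_desc wji); exact: dn_le.
have [vij|] := boolP (v i < v j)%N.
  by exists (tperm i j * w)%g => //; move: vw'; rewrite dn_asc.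
rewrite -perm_lt_total // => vji; rewrite dn_desc // in vw'.
have [||w' vw'' [w'w E]] := IH _ _ _ vw'; first by lia.
  by rewrite (inj_eq (mulgI _)).
have := ble_up hij vw''; rewrite up_asc ?tpermMl // tpermMK => vu.
have [w'ij|] := boolP (w' i < w' j)%N.
  exists (up i j w') => //; split; last by rewrite up_asc // ninv_asc; lia.
  by have := ble_up hij w'w; rewrite (up_asc (z := (_ * w)%g)) ?tpermMl // tpermMK.
rewrite -perm_lt_total // => w'ji; rewrite up_desc // in vu.
by exists (tperm i j * w)%g => //; exact: ble_trans vu w'w.
Qed.

Lemma exists_atom v w : ble v w -> v != w -> exists2 v', cov v v' & ble v' w.
Proof.
move=> vw nvw; have [|x wx xv] := exists_coatom (ble_flip vw).
  by rewrite (inj_eq (can_inj flipK)) eq_sym.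
exists (flip x); last by apply/ble_flipE; rewrite flipK.
by rewrite -(flipK v); exact: cov_flip.
Qed.

Lemma cov_tperm v w : cov v w ->
  exists a b : 'I_n, [/\ (a < b)%N, (v a < v b)%N & w = (tperm a b * v)%g].
Proof.
have [m] := ubnP (ninv w); elim: m v w => // m IH v w wm [vw E].
have [w1|/exists_descent[i [j [hij wji]]]] := eqVneq w 1%g.
  by move: E; rewrite w1 ninv1.
have wE := ninv_desc hij wji; have vw' := ble_dn hij vw; rewrite (dn_desc wji) in vw'.
have [vij|] := boolP (v i < v j)%N.
  exists i, j; split=> //; first by rewrite hij.
  rewrite dn_asc // in vw'; rewrite -(tpermMK i j w); congr (_ * _)%g.
  by apply/esym/ble_eq => //; lia.
rewrite -perm_lt_total // => vji; rewrite dn_desc // in vw'.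
have vE := ninv_desc hij vji.
have [||a [b [ab yab yE]]] := IH _ _ _ (conj vw' _); [by lia|by lia|].
exists (tperm i j a), (tperm i j b).
(* Conjugating by the adjacent swap keeps [a < b] unless the pair is [(i, j)], in which case [w]
   would be [tperm i j * v], shorter than [v]. *)
have nab : (a, b) != (i, j).
  apply/eqP => -[ai bj]; move: yE; rewrite ai bj => /mulgI wv.
  by move: E; rewrite wv; lia.
have nba : (a, b) != (j, i).
  by apply/eqP => -[aj bi]; move: ab; rewrite aj bi hij; lia.
split; [by rewrite tperm_adj_ltn|by move: yab; rewrite !permM|].
rewrite -(tpermMK i j w) yE !mulgA; congr (_ * _)%g.
by rewrite -tpermJ /conjg tpermV !mulgA.
Qed.

(** * Linear functionals on Bruhat intervals *)

Section Functionals.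
Variable R : realFieldType.
Implicit Types L : 'I_n -> R.
Local Open Scope ring_scope.

Definition ev L z : R := \sum_i L i * (z i).+1%:R.

Lemma ev_tperm L i j z : ev L (tperm i j * z)%g = ev (L \o tperm i j) z.
Proof.
rewrite /ev [RHS](reindex_inj (@perm_inj _ (tperm i j))) /=.
by apply: eq_bigr => k _; rewrite tpermK permM.
Qed.

(** The two points differ by a multiple of e_i - e_j; hence comparing values of [ev] across a cover
    amounts to comparing two coefficients. *)
Lemma ev_swap L i j z :
  ev L (tperm i j * z)%g - ev L z = (L i - L j) * ((z j)%:R - (z i)%:R).
Proof.
have [<-|ij] := eqVneq i j; first by rewrite tperm1 mul1g !subrr mul0r.
have ji : j != i by rewrite eq_sym.
rewrite /ev -sumrB (bigD1 i) //= (bigD1 j) //= !permM tpermL tpermR.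
rewrite big1 => [|k /andP[ki kj]]; last by rewrite permM tpermD 1?eq_sym // subrr.
by rewrite -![(_.+1)%:R]natr1; ring.
Qed.

Lemma subr_ord_gt0 i j : (i < j)%N -> 0 < j%:R - i%:R :> R.
Proof. by rewrite subr_gt0 ltr_nat. Qed.

Lemma ev_le_swap L i j z : (z i < z j)%N ->
  (ev L z <= ev L (tperm i j * z)%g) = (L j <= L i).
Proof.
by move=> /subr_ord_gt0 zij; rewrite -subr_ge0 ev_swap (pmulr_lge0 _ zij) subr_ge0.
Qed.

Lemma ev_lt_swap L i j z : (z i < z j)%N ->
  (ev L z < ev L (tperm i j * z)%g) = (L j < L i).
Proof.
by move=> /subr_ord_gt0 zij; rewrite -subr_gt0 ev_swap (pmulr_lgt0 _ zij) subr_gt0.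
Qed.

Lemma cov_up i j z : j = i.+1 :> nat -> (z i < z j)%N -> cov z (tperm i j * z)%g.
Proof.
by move=> hij zij; split; [rewrite -(up_asc zij); exact: le_up|rewrite ninv_asc].
Qed.

Lemma cov_dn i j z : j = i.+1 :> nat -> (z j < z i)%N -> cov (tperm i j * z)%g z.
Proof.
by move=> hij zij; split; [rewrite -(dn_desc zij); exact: dn_le|rewrite -ninv_desc].
Qed.

(** Were [y] to descend at [i], lifting would give [ble v y], and equal length would force [y = v].
    So [y] ascends, and its swap is an atom of [[v, w]]. This carries hypotheses on the atoms of
    [[v, w]] over to the interval with both ends swapped. *)
Lemma atom_lift i j v w y : j = i.+1 :> nat -> (v j < v i)%N -> (w j < w i)%N ->
  cov (tperm i j * v)%g y -> ble y (tperm i j * w)%g -> y != v ->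
  cov v (tperm i j * y)%g /\ ble (tperm i j * y)%g w.
Proof.
move=> hij vji wji [vy yE] yw ny; have vE := ninv_desc hij vji.
have vu := ble_up hij vy; rewrite up_asc ?tpermMl // tpermMK in vu.
have [yij|] := boolP (y i < y j)%N; last first.
  rewrite -perm_lt_total // => yji; rewrite up_desc // in vu.
  by case/eqP: ny; apply/esym/ble_eq => //; lia.
rewrite up_asc // in vu; split; first by split; rewrite // ninv_asc //; lia.
by have := ble_up hij yw; rewrite (up_asc yij) up_asc ?tpermMl // tpermMK.
Qed.

(** In dual terms, the atoms span the cone of [[v, w]] at [v]. Let s be a descent of [w]. If [v] is
    below sw and [L j <= L i], pass through [[v, sw]]. Otherwise pass to [[sv, sw]] with [L]
    composed with s: the only atom there that may not come from [[v, w]] is [v], and for it the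
    failed alternative gives [L i < L j]. *)
Lemma ev_le_of_atoms L v w : ble v w ->
  (forall y, cov v y -> ble y w -> ev L v <= ev L y) -> ev L v <= ev L w.
Proof.
have [m] := ubnP (ninv w); elim: m L v w => // m IH L v w wm vw atoms.
have [w1|/exists_descent[i [j [hij wji]]]] := eqVneq w 1%g.
  by move: vw; rewrite w1 => vw; rewrite (ble_anti vw (ble1 v)).
have wE := ninv_desc hij wji; have := ble_dn hij vw; rewrite (dn_desc wji).
have [sww _] := cov_dn hij wji.
have below : ble v (tperm i j * w)%g -> L j <= L i -> ev L v <= ev L w.
  move=> vsw Lji; apply: (@le_trans _ _ (ev L (tperm i j * w)%g)).
    by apply: IH => // [|y vy yw]; [lia|apply: atoms => //; exact: ble_trans sww].
  by rewrite -[w in leRHS](tpermMK i j) ev_le_swap ?tpermMl.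
have [vij|] := boolP (v i < v j)%N.
  rewrite dn_asc // => vsw; apply: below => //.
  rewrite -(ev_le_swap _ vij); apply: atoms; first exact: cov_up.
  by have := ble_up hij vw; rewrite up_asc // up_desc.
rewrite -perm_lt_total // => vji; rewrite dn_desc // => svw.
have [[vsw Lji]|nb] := pselect (ble v (tperm i j * w)%g /\ L j <= L i); first exact: below.
rewrite -(tpermMK i j v) -(tpermMK i j w) !(ev_tperm L i j (_ * _)).
apply: IH => // [|y svy yw]; first by rewrite -ltnS -wE.
rewrite -!ev_tperm tpermMK; have [yv|nyv] := eqVneq y v.
  move: yw nb; rewrite yv => vsw nb; rewrite leNgt; apply/negP => lt; apply: nb.
  split=> //; apply: ltW; move: lt.
  by rewrite -{2}(tpermMK i j v) ev_lt_swap ?tpermMl.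
have [c yw'] := atom_lift hij vji wji svy yw nyv; exact: atoms.
Qed.

Lemma ev_lt_of_atoms L v w : ble v w -> v != w ->
  (forall y, cov v y -> ble y w -> ev L v < ev L y) -> ev L v < ev L w.
Proof.
have [m] := ubnP (ninv w); elim: m L v w => // m IH L v w wm vw nvw atoms.
have [w1|/exists_descent[i [j [hij wji]]]] := eqVneq w 1%g.
  by move: vw nvw; rewrite w1 => vw; rewrite (ble_anti vw (ble1 v)) eqxx.
have wE := ninv_desc hij wji; have := ble_dn hij vw; rewrite (dn_desc wji).
have [sww _] := cov_dn hij wji.
have atoms' y : cov v y -> ble y (tperm i j * w)%g -> ev L v < ev L y.
  by move=> vy yw; apply: atoms => //; exact: ble_trans sww.
have below : ble v (tperm i j * w)%g -> L j < L i -> ev L v < ev L w.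
  move=> vsw Lji; apply: (@le_lt_trans _ _ (ev L (tperm i j * w)%g)).
    by apply: ev_le_of_atoms => // y vy /(atoms' _ vy)/ltW.
  by rewrite -[w in ltRHS](tpermMK i j) ev_lt_swap ?tpermMl.
have [vij|] := boolP (v i < v j)%N.
  rewrite dn_asc // => vsw; apply: below => //.
  rewrite -(ev_lt_swap _ vij); apply: atoms; first exact: cov_up.
  by have := ble_up hij vw; rewrite up_asc // up_desc.
rewrite -perm_lt_total // => vji; rewrite dn_desc // => svw.
have [[vsw Lji]|nb] := pselect (ble v (tperm i j * w)%g /\ L j <= L i).
  have [Eji|nji] := eqVneq (L j) (L i); last first.
    by apply: below => //; rewrite lt_neqAle nji.
  (* On a tie sw and [w] have the same value, so strictness has to come from [[v, sw]], which is
     nontrivial because [v] descends at [i] and sw does not. *)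
  rewrite -[w](tpermMK i j).
  have -> : ev L (tperm i j * (tperm i j * w))%g = ev L (tperm i j * w)%g.
    by apply/eqP; rewrite -subr_eq0 ev_swap Eji subrr mul0r.
  apply: IH => //; first by lia.
  by apply/eqP => E; move: vji; rewrite E !tpermMl; lia.
rewrite -(tpermMK i j v) -(tpermMK i j w) !(ev_tperm L i j (_ * _)).
apply: IH => // [||y svy yw]; first by rewrite -ltnS -wE.
  by rewrite (inj_eq (mulgI _)).
rewrite -!ev_tperm tpermMK; have [yv|nyv] := eqVneq y v.
  move: yw nb; rewrite yv => vsw nb; rewrite ltNge; apply/negP => le; apply: nb.
  split=> //; move: le.
  by rewrite -{2}(tpermMK i j v) ev_le_swap ?tpermMl.
have [c yw'] := atom_lift hij vji wji svy yw nyv; exact: atoms.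
Qed.

Definition const_on L v w := forall x, ble v x -> ble x w -> ev L x = ev L v.

(** Quantified over [v] and [L] because the induction changes both. *)
Definition facet_claim (w' w : 'S_n) := forall v L, ble v w' -> const_on L v w' ->
  ev L w' <= ev L w -> forall z, ble v z -> ble z w ->
  ev L v <= ev L z /\ (ev L w' < ev L w -> ev L z = ev L v -> ble z w').

(** Since sw is not [w'], [w'] also descends at s, and the claim for sw' and sw is to be lifted. If
    [v] is below sw', then s does not affect [L]; otherwise the claim is used for sv and [L]
    composed with s. *)
Lemma facet_right i j w' w : j = i.+1 :> nat -> (w j < w i)%N ->
  cov w' w -> (tperm i j * w)%g != w' ->
  (cov (tperm i j * w')%g (tperm i j * w)%g ->
    facet_claim (tperm i j * w')%g (tperm i j * w)%g) ->
  facet_claim w' w.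
Proof.
move=> hij wji [w'w wE] nw' IH v L vw' vL Lw z vz zw.
have swE := ninv_desc hij wji.
have sw'w := ble_dn hij w'w; rewrite (dn_desc wji) in sw'w.
have [w'ij|] := boolP (w' i < w' j)%N.
  by case/eqP: nw'; rewrite dn_asc // in sw'w; apply/esym/ble_eq => //; lia.
rewrite -perm_lt_total // => w'ji; rewrite dn_desc // in sw'w.
have [sw'w' w'E] := cov_dn hij w'ji.
have {}IH : facet_claim (tperm i j * w')%g (tperm i j * w)%g by apply: IH; split=> //; lia.
have usw' : up i j (tperm i j * w')%g = w' by rewrite up_asc ?tpermMl // tpermMK.
have dz := ble_dn hij zw; rewrite (dn_desc wji) in dz.
have udz x : ble (dn i j x) (tperm i j * w')%g -> ble x w'.
  move=> /(ble_up hij); rewrite usw' up_dn // => ?.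
  exact: ble_trans (le_up x hij) _.
have [vsw'|nvsw'] := pselect (ble v (tperm i j * w')%g).
  (* Both [w'] and sw' lie in [[v, w']], where [L] is constant. *)
  have Lij : L i = L j.
    have := vL _ vw' (ble_refl _); rewrite -(vL _ vsw' sw'w') => /eqP.
    rewrite eq_sym -subr_eq0 ev_swap mulf_eq0 !subr_eq0 => /orP[/eqP //|].
    by rewrite eqr_nat => /eqP E; move: w'ji; rewrite E ltnn.
  have Ls x : ev L (tperm i j * x)%g = ev L x.
    by apply/eqP; rewrite -subr_eq0 ev_swap Lij subrr mul0r.
  have Ld x : ev L (dn i j x) = ev L x by rewrite /dn; case: ifP => _; rewrite ?Ls.
  have Lu x : ev L (up i j x) = ev L x by rewrite /up; case: ifP => _; rewrite ?Ls.
  have := IH (dn i j v) L; rewrite !Ld !Ls => /(_ _ _ Lw (dn i j z)).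
  rewrite Ld; case.
  - by rewrite -(dn_desc w'ji); exact: ble_dn.
  - move=> x vx xw'; rewrite Ld -Lu; apply: vL.
      apply: ble_trans (ble_up hij vx); rewrite up_dn //; exact: le_up.
    by have := ble_up hij xw'; rewrite usw'.
  - exact: ble_dn.
  - exact: dz.
  - by move=> h1 h2; split=> // h3 h4; apply/udz/h2.
have vji : (v j < v i)%N.
  rewrite perm_lt_total //; apply/negP => vij; apply: nvsw'.
  by rewrite -(dn_asc vij) -(dn_desc w'ji); exact: ble_dn.
have svw' := ble_dn hij vw'; rewrite !dn_desc // in svw'.
have [svv _] := cov_dn hij vji.
have Ls x : ev (L \o tperm i j) (tperm i j * x)%g = ev L x.
  by rewrite -ev_tperm tpermMK.
have K t : ble (tperm i j * v)%g t -> ble t (tperm i j * w)%g ->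
    ev L v <= ev L (tperm i j * t)%g /\
    (ev L w' < ev L w -> ev L (tperm i j * t)%g = ev L v -> ble t (tperm i j * w')%g).
  move=> svt tw.
  suff cL : const_on (L \o tperm i j) (tperm i j * v)%g (tperm i j * w')%g.
    by have := IH _ _ svw' cL; rewrite !Ls => /(_ Lw t svt tw); rewrite -ev_tperm.
  move=> y svy yw'; rewrite Ls -ev_tperm.
  (* A [y] descending at [i] would lie above [v], putting [v] below sw' after all. *)
  have yij : (y i < y j)%N.
    have [//|] := boolP (y i < y j)%N; rewrite -perm_lt_total // => yji.
    case: nvsw'; apply: ble_trans yw'; have := ble_up hij svy.
    by rewrite up_asc ?tpermMl // tpermMK up_desc.
  apply: vL.
    by have := ble_up hij svy; rewrite up_asc ?tpermMl // tpermMK up_asc.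
  by have := ble_up hij yw'; rewrite usw' up_asc.
have [zij|] := boolP (z i < z j)%N; last first.
  rewrite -perm_lt_total // => zji; rewrite dn_desc // in dz.
  have [||h1 h2] := K (tperm i j * z)%g => //.
    by have := ble_dn hij vz; rewrite !dn_desc.
  rewrite tpermMK in h1 h2; split=> // h3 h4; apply: udz; rewrite dn_desc //; exact: h2.
rewrite dn_asc // in dz.
(* Here [v] itself lies in [[sv, sw]], and [K] at [v] compares [v] with sv. The resulting sign shows
   that swapping [z] up does not increase [L]. *)
have Lij : L i <= L j.
  have [+ _] := K v svv (ble_trans vz dz).
  by rewrite -subr_ge0 ev_swap nmulr_lge0 ?subr_le0 // subr_lt0 ltr_nat.
have Lz : ev L (tperm i j * z)%g <= ev L z.
  by rewrite -subr_le0 ev_swap pmulr_lle0 ?subr_le0 // subr_gt0 ltr_nat.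
have [h1 h2] := K z (ble_trans svv vz) dz.
split=> [|h3 h4]; first exact: le_trans h1 Lz.
apply: ble_trans sw'w'; apply: h2 => //; apply/eqP.
by rewrite eq_le h1 -h4 Lz.
Qed.

(** The inequality is [ev_le_of_atoms] on [[v, z]]. If equality holds and [v != z], then by
    [ev_lt_of_atoms] some atom [y] of [[v, z]] has the value of [v]; so [y] is below [w'], [L] is
    constant on [[y, w']], and the argument repeats from [y]. *)
Lemma facet_of_atoms w' w :
  (forall v L y, ble v w' -> const_on L v w' -> ev L w' <= ev L w -> cov v y ->
    ble y w -> ev L v <= ev L y /\ (ev L w' < ev L w -> ev L y = ev L v -> ble y w')) ->
  facet_claim w' w.
Proof.
move=> atoms v L vw' vL Lw z vz zw; split.
  apply: ev_le_of_atoms => // y vy yz.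
  by have [] := atoms v L y vw' vL Lw vy (ble_trans yz zw).
move=> Lw' Lz; have [m] := ubnP (ninv z - ninv v).
elim: m v vw' vL vz Lz => // m IH v vw' vL vz Lz zm.
have [<- //|nvz] := eqVneq v z.
have [y [vy yz Ly]] : exists y, [/\ cov v y, ble y z & ev L y <= ev L v].
  apply: contrapT => H; suff : ev L v < ev L z by rewrite Lz ltxx.
  apply: ev_lt_of_atoms => // y vy yz; rewrite ltNge; apply/negP => Ly; apply: H.
  by exists y.
have [h1 h2] := atoms v L y vw' vL Lw vy (ble_trans yz zw).
have Ey : ev L y = ev L v by apply/eqP; rewrite eq_le Ly.
have [vy' yE] := vy.
apply: (IH y) => //; rewrite ?Ey //; first exact: h2.
  by move=> x yx xw'; rewrite Ey; apply: vL => //; exact: ble_trans yx.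
by have [vz' _] := ble_ninv_leq yz; lia.
Qed.

(* Along each cover x <. x (a b) of the interval, constancy forces L a = L b. *)
Lemma const_on_pointwise L v w : const_on L v w ->
  forall x, ble v x -> ble x w -> forall k, L ((x^-1)%g k) = L ((v^-1)%g k).
Proof.
move=> vL x; have [m] := ubnP (ninv x); elim: m x => // m IH x xm vx xw k.
have [-> //|nvx] := eqVneq v x.
have [y vy [yx yE]] := exists_coatom vx nvx.
have yw := ble_trans yx xw.
rewrite -(IH y) //; last by lia.
have [a [b [ab yab xE]]] := cov_tperm (conj yx yE).
have Lab : L a = L b.
  have /eqP := vL _ vx xw; rewrite -(vL _ vy yw) xE -subr_eq0 ev_swap mulf_eq0 !subr_eq0.
  by case/orP=> [/eqP //|]; rewrite eqr_nat => /eqP E; move: yab; rewrite E ltnn.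
rewrite xE invMg permM tpermV.
by case: tpermP => [->|->|].
Qed.

Lemma tpermMV a b z : ((tperm a b * z)^-1 = tperm (z a) (z b) * z^-1)%g.
Proof. by rewrite invMg tpermV -tpermJ /conjg !mulgA mulgK. Qed.

(* On [v, w'] the coefficient L k depends only on the value of the permutation at
   k, so L transports to the inverse permutations. *)
Lemma facet_inv w' w : cov w' w -> facet_claim (w'^-1)%g (w^-1)%g -> facet_claim w' w.
Proof.
move=> w'w H; apply: facet_of_atoms => v L y vw' vL Lw vy yw.
pose L' (k : 'I_n) := L ((v^-1)%g k).
have [a [b [ab w'ab wE]]] := cov_tperm w'w.
have [c [d [cd vcd yE]]] := cov_tperm vy.
have Lw'k k : L' (w' k) = L k.
  by rewrite /L' -(const_on_pointwise vL vw' (ble_refl _)) permK.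
have vL' : const_on L' (v^-1)%g (w'^-1)%g.
  (* Reindexing from values to positions gives a sum that does not depend on [x]. *)
  have E x : ble v x -> ble x w' -> ev L' (x^-1)%g = \sum_k L k * k.+1%:R.
    move=> vx xw'; rewrite /ev [RHS](reindex_inj (@perm_inj _ (x^-1)%g)) /=.
    by apply: eq_bigr => k _; rewrite (const_on_pointwise vL vx xw').
  move=> x /bleV; rewrite invgK => vx /bleV; rewrite invgK => xw'.
  by rewrite -(invgK x) !E.
have w'Vab : ((w'^-1)%g (w' a) < (w'^-1)%g (w' b))%N by rewrite !permK.
have vVcd : ((v^-1)%g (v c) < (v^-1)%g (v d))%N by rewrite !permK.
(* [L'] and [L] are compared only across a single swap, where the two pairs of coefficients
   coincide; this is why the claim was first reduced to atoms. *)
have L'w : ((ev L' (w'^-1)%g <= ev L' (w^-1)%g) = (ev L w' <= ev L w)) *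
    ((ev L' (w'^-1)%g < ev L' (w^-1)%g) = (ev L w' < ev L w)).
  by rewrite wE tpermMV !ev_le_swap // !ev_lt_swap // !Lw'k.
have L'y : ((ev L' (v^-1)%g <= ev L' (y^-1)%g) = (ev L v <= ev L y)) *
    ((ev L' (v^-1)%g < ev L' (y^-1)%g) = (ev L v < ev L y)).
  by rewrite yE tpermMV !ev_le_swap // !ev_lt_swap // /L' !permK.
have [vy' _] := vy.
have := H _ _ (bleV vw') vL'; rewrite !L'w => /(_ Lw _ (bleV vy') (bleV yw)).
rewrite L'y => -[h1 h2]; split=> // h3 h4.
rewrite -(invgK y) -(invgK w'); apply/bleV/h2 => //.
by apply/eqP; rewrite eq_le L'y h1 andbT leNgt L'y h4 ltxx.
Qed.

Lemma facetP w' w : cov w' w -> facet_claim w' w.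
Proof.
have [m] := ubnP (ninv w); elim: m w' w => // m IH w' w wm w'w.
have [[i [j [hij wji nw']]]|nr] := pselect (exists i j,
    [/\ j = i.+1 :> nat, (w j < w i)%N & (tperm i j * w)%g != w']).
  by apply: (facet_right hij) => //; apply: IH; rewrite -ltnS -ninv_desc.
have [[i [j [hij wji nw']]]|nl] := pselect (exists i j,
    [/\ j = i.+1 :> nat, ((w^-1)%g j < (w^-1)%g i)%N & (tperm i j * w^-1)%g != (w'^-1)%g]).
  apply: facet_inv => //; apply: (facet_right hij) => //; first exact: covV.
  by apply: IH; rewrite -ltnS -ninv_desc // ninvV.
(* Every descent of [w] and of its inverse now leads to [w']. So [w] has a single descent, its two
   values there are consecutive, and swapping them leaves no descent. *)
have w'1 : w' = 1%g.
  have w1 : w != 1%g.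
    by apply/eqP => w1; have [_] := w'w; rewrite w1 ninv1.
  have [i [j [hij wji]]] := exists_descent w1.
  have w1V : (w^-1)%g != 1%g by rewrite invg_eq1.
  have [c [d [hcd wdc]]] := exists_descent w1V.
  have E k k' : k' = k.+1 :> nat -> (w k' < w k)%N -> (tperm k k' * w)%g = w'.
    by move=> hk wk; apply/eqP/negPn/negP => h; apply: nr; exists k, k'.
  have E' : (tperm c d * w^-1)%g = (w'^-1)%g.
    by apply/eqP/negPn/negP => h; apply: nl; exists c, d.
  have sw := E _ _ hij wji.
  have : tperm (w i) (w j) = tperm c d.
    apply: (mulIg (w^-1)%g); rewrite E' -sw invMg tpermV.
    by rewrite -tpermJ /conjg !mulgA mulgK.
  move=> /permP Ecd.
  have [wic wjd] : w i = d /\ w j = c.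
    have := Ecd (w i); rewrite tpermL; case: tpermP => [wic wjd|-> ->|_ _ wji'] //.
      by move: wji; rewrite wic wjd hcd; lia.
    by move: wji; rewrite wji' ltnn.
  apply: no_descent => k k' hk; rewrite -[w']sw !permM.
  have nd : k != i -> (w k < w k')%N.
    move=> ki; have [//|] := boolP (w k < w k')%N.
    rewrite -perm_lt_total // => /(E _ _ hk); rewrite -sw => /mulIg/esym.
    by move=> /(tperm_adj_inj hij hk) [ik _]; rewrite ik eqxx in ki.
  have wij : (w i = (w j).+1 :> nat) by rewrite wic wjd hcd.
  have neq (a b : 'I_n) : a != b -> w a != w b :> nat by rewrite (inj_eq val_inj) (inj_eq perm_inj).
  have [ki|ki] := eqVneq k i.
    have -> : k' = j by apply: val_inj; rewrite /= hk hij ki.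
    by rewrite ki tpermL tpermR.
  have {nd} := nd ki; have k'j : k' != j.
    by apply: contraNneq ki => k'j; rewrite -val_eqE /=; move: hk; rewrite k'j hij => -[->].
  have [k'i|k'i] := eqVneq k' i.
    have kj : k != j by rewrite -val_eqE /= hij -k'i hk; lia.
    rewrite k'i tpermL tpermD 1?eq_sym //; have := neq _ _ kj; lia.
  have [->|kj] := eqVneq k j; last by rewrite !tpermD 1?eq_sym.
  by rewrite tpermR tpermD 1?eq_sym //; have := neq _ _ k'i; lia.
(* With [w' = 1], [w] has length one and the interval consists of 1 and [w]. *)
move=> v L vw' vL Lw z vz zw.
have v1 : v = 1%g by apply: ble_anti (ble1 v); rewrite -w'1.
have [zz1|nz1] := eqVneq z 1%g; first by rewrite zz1 v1; split=> // _ _; exact: ble1.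
have zwE : z = w.
  apply: ble_eq => //; have [_ ->] := w'w; rewrite w'1 ninv1.
  have [+ _] := ble_ninv_leq zw; have [_ ->] := w'w; rewrite w'1 ninv1.
  have : ninv z != 0%N by apply: contraNneq nz1 => /ninv_eq0 ->.
  by lia.
rewrite zwE v1 -w'1; split=> // Lw' E; by rewrite E ltxx in Lw'.
Qed.

End Functionals.

End Bruhat.

Local Open Scope classical_set_scope.
Local Open Scope ring_scope.

(** * Convex hulls, affine hulls and faces *)

Section Hulls.
Variables (R : realType) (n : nat).
Implicit Types (a x y : 'rV[R]_n) (S T : set 'rV[R]_n) (U : {vspace 'rV[R]_n}).

Definition dotr a x : R := \sum_i a 0 i * x 0 i.

Lemma dotrD a x y : dotr a (x + y) = dotr a x + dotr a y.
Proof. by rewrite /dotr -big_split; apply: eq_bigr => i _; rewrite mxE mulrDr. Qed.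

Lemma dotrZ a k x : dotr a (k *: x) = k * dotr a x.
Proof. by rewrite /dotr mulr_sumr; apply: eq_bigr => i _; rewrite mxE mulrCA. Qed.

Lemma dotrB a x y : dotr a (x - y) = dotr a x - dotr a y.
Proof. by rewrite dotrD -scaleN1r dotrZ mulN1r. Qed.

Lemma dotrZl k a x : dotr (k *: a) x = k * dotr a x.
Proof. by rewrite /dotr mulr_sumr; apply: eq_bigr => i _; rewrite mxE mulrA. Qed.

Lemma dotrNl a x : dotr (- a) x = - dotr a x.
Proof. by rewrite -scaleN1r dotrZl mulN1r. Qed.

Lemma separating_functional U x : x \notin U ->
  exists2 a, {in U, forall u, dotr a u = 0} & dotr a x = 1.
Proof.
(* [f] kills exactly [U], so some coordinate of [f x] is nonzero; that coordinate of [f], rescaled,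
   is the functional. *)
move=> xU; pose f : 'End('rV[R]_n) := (\1 - projv U)%VF.
have fE y : f y = y - projv U y by rewrite add_lfunE opp_lfunE id_lfunE.
have fU u : u \in U -> f u = 0 by move=> uU; rewrite fE projv_id // subrr.
have [j fxj] : exists j, f x 0 j != 0.
  apply: contrapT => H; case/negP: xU; suff : f x = 0.
    by rewrite fE => /eqP; rewrite subr_eq0 => /eqP ->; exact: memv_proj.
  by apply/rowP => j; rewrite mxE; apply: contrapT => /eqP h; apply: H; exists j.
pose a := (\row_i f (delta_mx 0 i) 0 j : 'rV[R]_n).
have aE y : dotr a y = f y 0 j.
  rewrite [in RHS](row_sum_delta y) linear_sum summxE; apply: eq_bigr => i _.
  by rewrite linearZ /= !mxE mulrC.
exists ((f x 0 j)^-1 *: a) => [u uU|].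
  by rewrite dotrZl aE (fU _ uU) mxE mulr0.
by rewrite dotrZl aE mulVf.
Qed.

Lemma sub_hull S : S `<=` convex_hull S.
Proof. exact: sub_gen_smallest. Qed.

Lemma hull_convex S : convex_set (convex_hull S : set (convex_lmodType 'rV[R]_n)).
Proof.
move=> x y l /set_mem hx /set_mem hy; apply/mem_set => M [cM SM].
by apply/set_mem/cM; apply/mem_set; [exact: hx|exact: hy].
Qed.

Lemma hull_sub S T : convex_set (T : set (convex_lmodType 'rV[R]_n)) -> S `<=` T ->
  convex_hull S `<=` T.
Proof. exact: smallest_sub. Qed.

Lemma hull_mono S T : S `<=` T -> convex_hull S `<=` convex_hull T.
Proof. by move=> ST; apply: (hull_sub (@hull_convex T)) => x /ST/sub_hull. Qed.

Lemma dotr_conv a (x y : convex_lmodType 'rV[R]_n) (k : {i01 R}) :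
  dotr a (conv k x y) = k%:num * dotr a x + (1 - k%:num) * dotr a y.
Proof. by rewrite -!dotrZ -dotrD. Qed.

Lemma convex_dotr_le a (b : R) :
  convex_set ([set x | dotr a x <= b] : set (convex_lmodType 'rV[R]_n)).
Proof.
apply/convex_setW => x y /set_mem /= hx /set_mem /= hy k k0 k1; apply/mem_set => /=.
rewrite dotr_conv; nra.
Qed.

Lemma convex_affine x U :
  convex_set (affine_subspace x U : set (convex_lmodType 'rV[R]_n)).
Proof.
move=> _ _ k /set_mem[u /= uU <-] /set_mem[v /= vU <-]; apply/mem_set.
exists (k%:num *: u + (1 - k%:num) *: v); first by rewrite /= memvD ?memvZ.
by rewrite -[RHS]/(k%:num *: (x + u) + (1 - k%:num) *: (x + v)) !scalerDr
  addrACA -scalerDl (addrC k%:num) subrK scale1r.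
Qed.

Lemma hull_face a (b : R) S T : S `<=` T -> (forall x, S x -> dotr a x = b) ->
  (forall x, T x -> S x \/ dotr a x < b) ->
  (forall x, convex_hull T x -> dotr a x <= b) /\
  convex_hull S = convex_hull T `&` [set x | dotr a x = b].
Proof.
move=> ST Sb TSb.
have Tb : convex_hull T `<=` [set x | dotr a x <= b].
  apply: (hull_sub (@convex_dotr_le a b)) => x /TSb[/Sb xb|/ltW //].
  by rewrite /= xb.
split; first exact: Tb.
have hSb x : convex_hull S x -> dotr a x = b.
  move=> hx; apply/eqP; rewrite eq_le (Tb x (hull_mono ST hx)) /=.
  suff : convex_hull S `<=` [set x | dotr (- a) x <= - b].
    by move=> /(_ _ hx) /=; rewrite dotrNl lerN2.
  apply: (hull_sub (@convex_dotr_le _ _)) => y /Sb <- /=.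
  by rewrite dotrNl.
apply/seteqP; split=> [x hx|x [hx /= xb]].
  by split; [exact: (hull_mono ST)|exact: hSb].
(* The points that are strict or lie in the hull of [S] form a convex set: a proper mixture
   involving a strict point is strict. *)
have : convex_hull T `<=` [set x | dotr a x < b \/ convex_hull S x].
  apply: hull_sub => [|y /TSb[/sub_hull|]]; [|by right|by left].
  apply/convex_setW => y z /set_mem /= hy /set_mem /= hz k k0 k1; apply/mem_set => /=.
  case: hy hz => [hy|hy] [hz|hz].
  - by left; rewrite dotr_conv; nra.
  - by left; rewrite dotr_conv (hSb z hz); nra.
  - by left; rewrite dotr_conv (hSb y hy); nra.
  - by right; apply/set_mem/hull_convex; apply/mem_set.
by move=> /(_ _ hx) /= [|//]; rewrite xb ltxx.
Qed.

Lemma affine_subspace_inj x y U V :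
  affine_subspace x U = affine_subspace y V -> U = V.
Proof.
have H x1 x2 (U1 U2 : {vspace 'rV[R]_n}) :
    affine_subspace x1 U1 = affine_subspace x2 U2 -> (U1 <= U2)%VS.
  move=> E; apply/subvP => u uU.
  have [u1 /= u1U u1E] : affine_subspace x2 U2 (x1 + u) by rewrite -E; exists u.
  have [u2 /= u2U u2E] : affine_subspace x2 U2 x1 by rewrite -E; exists 0; rewrite /= ?mem0v ?addr0.
  have -> : u = u1 - u2.
    have -> : u = (x1 + u) - x1 by rewrite addrC addKr.
    by rewrite -u1E -[X in _ - X]u2E opprD addrACA subrr add0r.
  exact: memvB.
by move=> E; apply/eqP; rewrite eqEsubv (H _ _ _ _ E) (H _ _ _ _ (esym E)).
Qed.

End Hulls.

(** * Functionals and faces at the level of permutations *)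

Section BruhatPolytopes.
Variables (R : realType) (n : nat).
Implicit Types (v w x y z : 'S_n) (L : 'I_n -> R) (a : 'rV[R]_n).

Local Notation pt := (@perm_point R n).

Lemma evN L z : ev (fun i => - L i) z = - ev L z.
Proof. by rewrite /ev -sumrN; apply: eq_bigr => i _; rewrite mulNr. Qed.

Lemma evD_scale L1 L2 (k : R) z :
  ev (fun i => L1 i + k * L2 i) z = ev L1 z + k * ev L2 z.
Proof.
by rewrite /ev mulr_sumr -big_split; apply: eq_bigr => i _; rewrite mulrDl mulrA.
Qed.

Lemma dotr_pt a z : dotr a (pt z) = ev (a 0) z.
Proof. by apply: eq_bigr => i _; rewrite mxE. Qed.

Lemma ev_flip L z : ev L (flip z) = \sum_i L i * n.+1%:R - ev L z.
Proof.
rewrite /ev -sumrB; apply: eq_bigr => i _; rewrite -mulrBr; congr (_ * _).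
apply/eqP; rewrite eq_sym subr_eq -natrD; apply/eqP; congr _%:R.
by rewrite flipE; have := ltn_ord (z i); lia.
Qed.

(** [flip] reverses the order and negates every functional up to a constant, so this is [facetP] on
    [[flip w, flip v]] with the same [L]. *)
Lemma facet_dual v v' w L z : cov v v' -> ble v' w ->
  (forall x, ble v' x -> ble x w -> ev L x = ev L w) -> ev L v <= ev L v' ->
  ble v z -> ble z w ->
  ev L z <= ev L w /\ (ev L v < ev L v' -> ev L z = ev L w -> ble v' z).
Proof.
move=> vv' v'w cL Lv vz zw.
have cL' : const_on L (flip w) (flip v').
  move=> x /ble_flip; rewrite flipK => xw /ble_flip; rewrite flipK => v'x.
  by rewrite -(flipK x) (ev_flip L (flip x)) [ev L (flip w)]ev_flip (cL (flip x)).
have Lv' : ev L (flip v') <= ev L (flip v) by rewrite !ev_flip lerD2l lerN2.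
have [h1 h2] := facetP (cov_flip vv') (ble_flip v'w) cL' Lv' (ble_flip zw) (ble_flip vz).
rewrite !ev_flip in h1 h2; split=> [|Lvv' E]; first by move: h1; lra.
by apply/ble_flipE/h2; [lra|rewrite E].
Qed.

(** Being a face, recorded on the vertices only; transitivity then involves finitely many
    comparisons. *)
Definition exposed (F V : 'S_n -> Prop) : Prop :=
  (forall z, F z -> V z) /\
  exists L c, (forall z, F z -> ev L z = c) /\ (forall z, V z -> F z \/ ev L z < c).

Lemma exposed_refl F : exposed F F.
Proof.
split=> //; exists (fun=> 0), 0; split=> [z _|z]; last by left.
by rewrite /ev big1 // => i _; rewrite mul0r.
Qed.

Lemma exposed_trans F G V : exposed F G -> exposed G V -> exposed F V.
Proof.
move=> [FG [L1 [c1 [F1 G1]]]] [GV [L2 [c2 [G2 V2]]]]; split=> [z /FG/GV //|].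
(* [k] has to exceed [(ev L1 z - c1) / (c2 - ev L2 z)] for every [z] outside [G]; the absolute
   values keep all other terms of the sum nonnegative. *)
pose k : R := 1 + \sum_z `|ev L1 z - c1| / `|c2 - ev L2 z|.
exists (fun i => L1 i + k * L2 i), (c1 + k * c2); split=> z.
  by move=> Fz; rewrite evD_scale F1 // G2 //; exact: FG.
rewrite evD_scale; case/V2 => [Gz|z2].
  by have [|z1] := G1 z Gz; [left|right; rewrite G2 // ltrD2r].
right; have d0 : 0 < c2 - ev L2 z by rewrite subr_gt0.
suff : ev L1 z - c1 < k * (c2 - ev L2 z) by rewrite mulrBr; lra.
apply: le_lt_trans (ler_norm _) _; rewrite -ltr_pdivrMr //.
rewrite /k (bigD1 z) //= [`|c2 - _|]gtr0_norm // addrA.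
apply: ltr_wpDr; first by apply: sumr_ge0 => y _; rewrite divr_ge0.
by rewrite addrC ltrDl.
Qed.

Definition within v w z : Prop := ble v z /\ ble z w.

Lemma bruhat_intervalE v w : bruhat_interval v w = within v w.
Proof.
by apply/seteqP; split=> z [/bruhat_leP vz /bruhat_leP zw].
Qed.

Lemma exposed_face x y v w : exposed (within x y) (within v w) ->
  is_face (bruhat_polytope R x y) (bruhat_polytope R v w).
Proof.
move=> [xyvw [L [c [hL1 hL2]]]].
pose a := (\row_i L i : 'rV[R]_n).
have aE z : dotr a (pt z) = ev L z by apply: eq_bigr => i _; rewrite !mxE.
exists a, c; apply: hull_face; rewrite !bruhat_intervalE.
- by move=> _ [z xz <-]; exists z => //; exact: xyvw.
- by move=> _ [z xz <-]; rewrite aE; exact: hL1.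
- move=> _ [z /hL2[xz|zc] <-]; [left; exact: imageP|by right; rewrite aE].
Qed.

(** * Direction spaces of the affine hulls, and dimension *)

Definition dir v w : {vspace 'rV[R]_n} :=
  (\sum_(z | `[< within v w z >]) <[pt z - pt v]>)%VS.

Lemma mem_dir v w z : within v w z -> pt z - pt v \in dir v w.
Proof.
move=> vzw; apply: (subvP (sumv_sup z (introT (asboolP _) vzw) (subvv _))).
exact: memv_line.
Qed.

Lemma pt_in_polytope v w z : within v w z -> bruhat_polytope R v w (pt z).
Proof. by move=> vzw; apply: sub_hull; apply: imageP; rewrite bruhat_intervalE. Qed.

Lemma dotr_dir_eq0 v w a : (forall z, within v w z -> dotr a (pt z - pt v) = 0) ->
  {in dir v w, forall u, dotr a u = 0}.
Proof.
move=> H u /memv_sumP[f fl ->].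
rewrite (big_morph (dotr a) (dotrD a) (_ : _ = 0)); last first.
  by rewrite -[0](scale0r 0) dotrZ mul0r.
apply: big1 => z zw; have /vlineP[k ->] := fl z zw.
by rewrite dotrZ H ?mulr0 //; exact/asboolP.
Qed.

Lemma dir_sub v w (U : {vspace 'rV[R]_n}) :
  (forall z, within v w z -> pt z - pt v \in U) -> (dir v w <= U)%VS.
Proof. by move=> H; apply/subv_sumP => z /asboolP/H; rewrite memvE. Qed.

Lemma hull_dir v w : ble v w ->
  affine_hull (bruhat_polytope R v w) = affine_subspace (pt v) (dir v w).
Proof.
move=> vw; apply/seteqP; split.
  apply: smallest_sub; first by exists (pt v), (dir v w).
  apply: (hull_sub (@convex_affine _ _ _ _)) => _ [z + <-].
  rewrite bruhat_intervalE => /mem_dir h.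
  by exists (pt z - pt v) => //; rewrite addrC subrK.
move=> _ [u /= ud <-] A [[p [U ->]] VA].
have VA' z : within v w z -> affine_subspace p U (pt z).
  by move=> vzw; exact: (VA _ (pt_in_polytope vzw)).
have [u0 /= u0U u0E] := VA' v (conj (ble_refl v) vw).
have dU : (dir v w <= U)%VS.
  apply: dir_sub => z /VA'[u1 /= u1U <-].
  by rewrite -u0E opprD addrACA subrr add0r memvB.
exists (u0 + u); first by rewrite /= memvD // (subvP dU).
by rewrite addrA u0E.
Qed.

Lemma toricP v w : ble v w -> toric R v w <-> \dim (dir v w) = (ninv w - ninv v)%N.
Proof.
move=> vw; rewrite /toric !coxeter_lengthE; split=> [[p [U []]]|E].
  by rewrite hull_dir // => /affine_subspace_inj <-.
by exists (pt v), (dir v w); rewrite hull_dir.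
Qed.

Lemma mem_of_functionals (U : {vspace 'rV[R]_n}) (x : 'rV[R]_n) :
  (forall a, {in U, forall u, dotr a u = 0} -> dotr a x = 0) -> x \in U.
Proof.
move=> H; apply/negPn/negP => /separating_functional[a aU ax].
by move: (H a aU); rewrite ax => /eqP; rewrite oner_eq0.
Qed.

Lemma dir_const v w a : {in dir v w, forall u, dotr a u = 0} ->
  forall z, within v w z -> ev (a 0) z = ev (a 0) v.
Proof.
by move=> ad z /mem_dir/ad; rewrite dotrB !dotr_pt => /eqP; rewrite subr_eq0 => /eqP.
Qed.

(** Both [L] and its negative satisfy the hypotheses of [facetP], so [ev L v] is at once a minimum
    and a maximum. *)
Lemma ev_const_coatom v w' w L : ble v w' -> cov w' w -> const_on L v w' ->
  ev L w = ev L v -> forall z, within v w z -> ev L z = ev L v.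
Proof.
move=> vw' w'w cL Lw z [vz zw].
have Lw' : ev L w' = ev L v by exact: cL.
have cN : const_on (fun i => - L i) v w' by move=> x vx xw'; rewrite !evN cL.
have [|h1 _] := facetP w'w vw' cL _ vz zw; first by rewrite Lw' Lw.
have [|h2 _] := facetP w'w vw' cN _ vz zw; first by rewrite !evN Lw' Lw.
by apply/eqP; rewrite eq_le h1 andbT -lerN2 -!evN.
Qed.

Lemma ev_const_atom v v' w L : cov v v' -> ble v' w ->
  (forall x, within v' w x -> ev L x = ev L w) ->
  ev L v = ev L w -> forall z, within v w z -> ev L z = ev L w.
Proof.
move=> vv' v'w cL Lv z [vz zw].
have Lv' : ev L v' = ev L w by apply: cL; split.
have cL' x : ble v' x -> ble x w -> ev L x = ev L w by move=> *; apply: cL.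
have cN x : ble v' x -> ble x w -> ev (fun i => - L i) x = ev (fun i => - L i) w.
  by move=> *; rewrite !evN cL'.
have [|h1 _] := facet_dual vv' v'w cL' _ vz zw; first by rewrite Lv' Lv.
have [|h2 _] := facet_dual vv' v'w cN _ vz zw; first by rewrite !evN Lv' Lv.
by apply/eqP; rewrite eq_le h1 -lerN2 -!evN.
Qed.

(** By duality it suffices that every functional vanishing on the right-hand side vanishes on the
    left, which is [ev_const_coatom]. *)
Lemma dir_coatom v w' w : ble v w' -> cov w' w ->
  (dir v w <= dir v w' + <[pt w - pt v]>)%VS.
Proof.
move=> vw' w'w; apply: dir_sub => z vzw; apply: mem_of_functionals => a aU.
have cL : const_on (a 0) v w'.
  move=> x vx xw'; apply: (dir_const (w := w')) => // u uU.
  by apply: aU; exact: (subvP (addvSl _ _)).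
have Lw : ev (a 0) w = ev (a 0) v.
  apply/eqP; rewrite -subr_eq0 -!dotr_pt -dotrB aU //.
  by apply: (subvP (addvSr _ _)); exact: memv_line.
by rewrite dotrB !dotr_pt (ev_const_coatom vw' w'w cL Lw vzw) subrr.
Qed.

Lemma dir_atom v v' w : cov v v' -> ble v' w ->
  (dir v w <= dir v' w + <[(pt v' - pt v)%R]>)%VS.
Proof.
move=> vv' v'w; apply: dir_sub => z vzw; apply: mem_of_functionals => a aU.
have cL x : within v' w x -> ev (a 0) x = ev (a 0) w.
  have cd y : within v' w y -> ev (a 0) y = ev (a 0) v'.
    apply: dir_const => u uU; by apply: aU; exact: (subvP (addvSl _ _)).
  by move=> /cd ->; rewrite (cd w (conj v'w (ble_refl w))).
have Lv : ev (a 0) v = ev (a 0) w.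
  rewrite -(cL v' (conj (ble_refl v') v'w)); apply/eqP.
  rewrite eq_sym -subr_eq0 -!dotr_pt -dotrB aU //.
  by apply: (subvP (addvSr _ _)); exact: memv_line.
have [vv _] := vv'; have vw := ble_trans vv v'w.
have vvw : within v w v by split.
by rewrite dotrB !dotr_pt !(ev_const_atom vv' v'w cL Lv) ?subrr.
Qed.

Lemma dim_add_line (U : {vspace 'rV[R]_n}) (x : 'rV[R]_n) : (\dim (U + <[x]>) <= (\dim U).+1)%N.
Proof.
apply: leq_trans (dimv_add_leqif _ _) _.
by rewrite dim_vline; case: eqP => _; rewrite ?addn0 ?addn1.
Qed.

Lemma dim_dir_coatom v w' w : ble v w' -> cov w' w ->
  (\dim (dir v w) <= (\dim (dir v w')).+1)%N.
Proof.
by move=> vw' w'w; apply: leq_trans (dimvS (dir_coatom vw' w'w)) (dim_add_line _ _).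
Qed.

Lemma dim_dir_atom v v' w : cov v v' -> ble v' w ->
  (\dim (dir v w) <= (\dim (dir v' w)).+1)%N.
Proof.
by move=> vv' v'w; apply: leq_trans (dimvS (dir_atom vv' v'w)) (dim_add_line _ _).
Qed.

Lemma dim_dir_le v w : ble v w -> (\dim (dir v w) <= ninv w - ninv v)%N.
Proof.
have [m] := ubnP (ninv w); elim: m w => // m IH w wm vw.
have [vE|nvw] := eqVneq v w.
  rewrite vE subnn leqn0 dimv_eq0 -subv0; apply: dir_sub => z [wz zw].
  by rewrite (ble_anti wz zw) subrr mem0v.
have [w' vw' w'w] := exists_coatom vw nvw.
have := dim_dir_coatom vw' w'w; have [w'lew wE] := w'w.
have [h1 _] := ble_ninv_leq vw'.
by have := IH w' _ vw'; rewrite wE in wm *; lia.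
Qed.

(** * Toric intervals and their faces *)

Definition full_dim v w := \dim (dir v w) = (ninv w - ninv v)%N.

(** The dimension drops by at most one and never exceeds the length, so equality is inherited. *)
Lemma full_dim_coatom v w' w : ble v w' -> cov w' w -> full_dim v w -> full_dim v w'.
Proof.
rewrite /full_dim => vw' w'w; have := dim_dir_coatom vw' w'w.
have := dim_dir_le vw'; have [_ ->] := w'w; have [h1 _] := ble_ninv_leq vw'.
by lia.
Qed.

Lemma full_dim_atom v v' w : cov v v' -> ble v' w -> full_dim v w -> full_dim v' w.
Proof.
rewrite /full_dim => vv' v'w; have := dim_dir_atom vv' v'w.
have := dim_dir_le v'w; have [_ ->] := vv'; have [h1 _] := ble_ninv_leq v'w.
by lia.
Qed.

Lemma exposed_coatom v w' w : ble v w' -> cov w' w -> full_dim v w ->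
  exposed (within v w') (within v w).
Proof.
move=> vw' w'w full; have [w'lew wE] := w'w.
split=> [z [vz zw']|]; first by split=> //; exact: ble_trans w'lew.
(* If [pt w - pt v] lay in [dir v w'], the direction space would not grow from [w'] to [w], against
   full dimension. *)
have [a aU aw] : exists2 a, {in dir v w', forall u, dotr a u = 0} & dotr a (pt w - pt v) = 1.
  apply: separating_functional; apply/negP => wd.
  have := dimvS (dir_coatom vw' w'w); rewrite (addv_idPl _); last by rewrite -memvE.
  rewrite full wE; have := dim_dir_le vw'; have [h1 _] := ble_ninv_leq vw'.
  by lia.
have cL : const_on (a 0) v w' by move=> x vx xw'; apply: (dir_const aU); split.
have Lw : ev (a 0) w = ev (a 0) v + 1 by move: aw; rewrite dotrB !dotr_pt; lra.
have Lw' : ev (a 0) w' = ev (a 0) v by exact: cL.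
have lt : ev (a 0) w' < ev (a 0) w by rewrite Lw Lw' ltrDl.
(* [facetP] makes [[v, w']] the set of minima, while [exposed] asks for maxima; hence the sign. *)
exists (fun i => - a 0 i), (- ev (a 0) v); split=> [z [vz zw']|z [vz zw]].
  by rewrite evN cL.
have [h1 h2] := facetP w'w vw' cL (ltW lt) vz zw; rewrite evN ltrN2.
have [E|nE] := eqVneq (ev (a 0) z) (ev (a 0) v); first by left; split=> //; exact: h2.
by right; rewrite lt_neqAle eq_sym nE.
Qed.

Lemma exposed_atom v v' w : cov v v' -> ble v' w -> full_dim v w ->
  exposed (within v' w) (within v w).
Proof.
move=> vv' v'w full; have [vlev' v'E] := vv'.
split=> [z [v'z zw]|]; first by split=> //; exact: ble_trans v'z.
have [a aU aw] : exists2 a, {in dir v' w, forall u, dotr a u = 0} & dotr a (pt v' - pt v) = 1.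
  apply: separating_functional; apply/negP => wd.
  have := dimvS (dir_atom vv' v'w); rewrite (addv_idPl _); last by rewrite -memvE.
  rewrite full; have := dim_dir_le v'w; have [h1 _] := ble_ninv_leq v'w.
  by rewrite v'E in h1 *; lia.
have cd y : within v' w y -> ev (a 0) y = ev (a 0) v' by exact: dir_const.
have Lw : ev (a 0) w = ev (a 0) v' by apply: cd; split.
have cL x : ble v' x -> ble x w -> ev (a 0) x = ev (a 0) w.
  by move=> v'x xw; rewrite Lw; apply: cd; split.
have lt : ev (a 0) v < ev (a 0) v' by move: aw; rewrite dotrB !dotr_pt; lra.
exists (a 0), (ev (a 0) w); split=> [z [v'z zw]|z [vz zw]]; first exact: cL.
have [h1 h2] := facet_dual vv' v'w cL (ltW lt) vz zw.
have [E|nE] := eqVneq (ev (a 0) z) (ev (a 0) w); first by left; split=> //; exact: h2.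
by right; rewrite lt_neqAle nE.
Qed.

(** Peel off coatoms until the top is [y], then atoms until the bottom is [x]; each step is a face
    of the previous interval and keeps full dimension. *)
Lemma exposed_subinterval v x y w : ble v x -> ble x y -> ble y w -> full_dim v w ->
  exposed (within x y) (within v w).
Proof.
have [m] := ubnP (ninv w - ninv v); elim: m v w => // m IH v w vwm vx xy yw full.
have [h1 _] := ble_ninv_leq vx; have [h2 _] := ble_ninv_leq xy.
have [h3 _] := ble_ninv_leq yw.
have [yE|nyw] := eqVneq y w; last first.
  have [w' yw' w'w] := exists_coatom yw nyw; have [_ wE] := w'w.
  have vw' := ble_trans vx (ble_trans xy yw').
  apply: exposed_trans (exposed_coatom vw' w'w full).
  apply: IH => //; last exact: full_dim_coatom full.
  by have [h4 _] := ble_ninv_leq yw'; lia.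
have [<-|nvx] := eqVneq v x; first by rewrite yE; exact: exposed_refl.
have [v' vv' v'x] := exists_atom vx nvx; have [_ v'E] := vv'.
have v'w := ble_trans v'x (ble_trans xy yw).
apply: exposed_trans (exposed_atom vv' v'w full).
apply: IH => //; last exact: full_dim_atom full.
by have [h4 _] := ble_ninv_leq v'x; lia.
Qed.

(* Decreasing coefficients make a functional strictly increase along covers. *)
Lemma pt_notin_lower v w' w : cov w' w -> ~ bruhat_polytope R v w' (pt w).
Proof.
move=> w'w; pose a := (\row_i - (i%:R) : 'rV[R]_n).
have a_dec (i j : 'I_n) : (i < j)%N -> a 0 j < a 0 i.
  by move=> ij; rewrite !mxE ltrN2 ltr_nat.
have a_cov z z' : cov z z' -> ev (a 0) z < ev (a 0) z'.
  move=> /cov_tperm[c [d [cd zcd ->]]]; rewrite ev_lt_swap //; exact: a_dec.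
have mono z z' : ble z z' -> ev (a 0) z <= ev (a 0) z'.
  by move=> zz'; apply: ev_le_of_atoms => // y /a_cov/ltW.
suff : bruhat_polytope R v w' `<=` [set p | dotr a p <= ev (a 0) w'].
  by move=> H /H /=; rewrite dotr_pt leNgt a_cov.
apply: (hull_sub (@convex_dotr_le _ _ _ _)) => _ [z + <-].
by rewrite bruhat_intervalE => -[_ /mono] /=; rewrite dotr_pt.
Qed.

Lemma full_dim_of_faces v w : ble v w ->
  (forall y, ble v y -> ble y w -> is_face (bruhat_polytope R v y) (bruhat_polytope R v w)) ->
  full_dim v w.
Proof.
move=> vw faces; apply/eqP; rewrite eqn_leq dim_dir_le //=.
suff : forall m x, (ninv x < m)%N -> ble v x -> ble x w ->
    (ninv x - ninv v <= \dim (dir v x))%N by move=> /(_ _ w (ltnSn _)); apply.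
elim=> // m IH x xm vx xw; have [<-|nvx] := eqVneq v x; first by rewrite subnn.
have [x' vx' x'x] := exists_coatom vx nvx; have [x'lex xE] := x'x.
have x'w := ble_trans x'lex xw.
have vv : within v x' v by split.
have := IH x' _ vx' x'w; rewrite -xE in xm *.
have [a [b [_ FE]]] := faces x' vx' x'w.
have inw z : ble v z -> ble z w -> bruhat_polytope R v w (pt z).
  by move=> vz zw; apply: pt_in_polytope.
have ab z : within v x' z -> dotr a (pt z) = b.
  move=> [vz zx']; suff : bruhat_polytope R v x' (pt z) by rewrite FE => -[].
  exact: pt_in_polytope.
(* The functional cutting out the face of [x'] vanishes on [dir v x']. Were the new direction in
   that space, [pt x] would lie in the face, against [pt_notin_lower]. *)
have nx : pt x - pt v \notin dir v x'.
  apply/negP => xd; apply: (pt_notin_lower (v := v) x'x); rewrite FE; split.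
    exact: inw.
  have d0 : {in dir v x', forall u, dotr a u = 0}.
    by apply: dotr_dir_eq0 => z vzx'; rewrite dotrB (ab z) ?(ab v) ?subrr.
  by move: (d0 _ xd); rewrite dotrB (ab v) //= => /eqP; rewrite subr_eq0 => /eqP.
have sub : (dir v x' <= dir v x)%VS.
  by apply: dir_sub => z [vz zx']; apply: mem_dir; split=> //; exact: ble_trans x'lex.
have lt : (\dim (dir v x') < \dim (dir v x))%N.
  rewrite (ltn_leqif (dimv_leqif_sup sub)); apply/negP => /subvP le; case/negP: nx.
  by apply/le/mem_dir; split.
by have [h1 _] := ble_ninv_leq vx'; lia.
Qed.

End BruhatPolytopes.

Theorem theorem1p1 (R : realType) (n : nat) (v w : 'S_n)
    (hvw : bruhat_le v w) :
  toric R v w <->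
  (forall x y : 'S_n, bruhat_le x y ->
     bruhat_interval x y `<=` bruhat_interval v w ->
     is_face (bruhat_polytope R x y) (bruhat_polytope R v w)).
Proof.
have vw : ble v w by exact/bruhat_leP.
split=> [/(toricP R vw) full x y /bruhat_leP xy|faces].
  rewrite !bruhat_intervalE => xyvw; apply/exposed_face/exposed_subinterval => //.
  - by have [] := xyvw x (conj (ble_refl x) xy).
  - by have [] := xyvw y (conj xy (ble_refl y)).
apply/(toricP R vw)/full_dim_of_faces => // y vy yw; apply: faces; first exact/bruhat_leP.
by rewrite !bruhat_intervalE => z [vz zy]; split=> //; exact: ble_trans yw.
Qed.
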